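(* Let $m\ge 1$ be an integer and let $F/\mathbb{F}_q$ be an $m$-friendly algebraic function field, with associated place $Q$ and function $z_1$. Let $f_i=z_1^{i-1}$ for $i=1,\dots,m$ and $g_j=z_1^{m-j}$ for $j=1,\dots,m$. Then the functions $$f:=\sum_{i=1}^m A_if_i,\qquad g:=\sum_{j=1}^m B_jg_j$$ satisfy $$v_Q(f_ig_j)=m-1\quad\text{if and only if}\quad i=j.$$ Consequently, they form a Matdot AG code, and its recovery threshold is $R=2g(F)+2m-1$.
   Context: Here $q$ is a prime power, $F/\mathbb{F}_q$ is an algebraic function field of one variable with full constant field $\mathbb{F}_q$ and genus $g(F)$; $v_P$ is the normalized discrete valuation at a place $P$, and $(z)_\infty$ is the pole divisor of $z$. Definition. An $m$-friendly algebraic function field is a function field $F/\mathbb{F}_q$ with a place $Q$ such that: (1) $g(F)=m-1$; (2) there exists $z_1\in F$ with $v_Q(z_1)=1$ and $\deg((z_1)_\infty)=2$. Matdot AG code: matrices $A\in\mathbb{F}_q^{r\times s}$, $B\in\mathbb{F}_q^{s\times t}$ with $m\mid s$ are partitioned into column blocks $A_1,\dots,A_m$ of $A$ and row blocks $B_1,\dots,B_m$ of $B$, so that $AB=\sum_{i=1}^mA_iB_i$. One chooses nonzero functions $f_1,\dots,f_m,g_1,\dots,g_m\in F$ such that, for the place $Q$ and some integer $d$, $v_Q(f_ig_j)=d$ if and only if $i=j$. Put $f=\sum_iA_if_i$, $g=\sum_jB_jg_j$, $h=fg=\sum_{i,j}A_iB_jf_ig_j$. The pole divisor $(h)_\infty$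 is understood as that of the code, independently of the particular $A,B$: it is the least common multiple (place-wise maximum) of the pole divisors $(f_ig_j)_\infty$, $1\le i,j\le m$. The recovery threshold is $R=\deg((h)_\infty)+1$. *)

(* Defs.v *)
From HB Require Import structures.
From mathcomp Require Import all_boot all_order all_algebra.
From mathcomp Require Import boolp classical_sets functions cardinality fsbigop.
From mathcomp Require Import constructive_ereal.

Set Implicit Arguments.
Unset Strict Implicit.
Unset Printing Implicit Defensive.

Import Order.TTheory GRing.Theory Num.Theory.

Local Open Scope classical_set_scope.
Local Open Scope ring_scope.

(* An algebraic function field of one variable over the finite field Fq, with
   full constant field Fq: F is a finite extension of the rational function
   field Fq(x) for some x transcendental over Fq, and every element of F that
   is algebraic over Fq is a constant. *)
Record functionField (Fq : finFieldType) := FunctionField {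
  ff_sort :> fieldType ;
  ff_const : {rmorphism Fq -> ff_sort} ;
  ff_one_variable : exists x : ff_sort, ~ algebraicOver ff_const x /\
    exists n (e : 'I_n -> ff_sort), forall z, exists p q : 'I_n -> {poly Fq},
      (forall i, q i != 0) /\
      z = \sum_i (map_poly ff_const (p i)).[x] /
                 (map_poly ff_const (q i)).[x] * e i ;
  ff_full_constants :
    forall z, algebraicOver ff_const z -> exists c, z = ff_const c
}.

(* Places are identified with their normalized discrete valuations
   v : F -> Z \cup {oo}, trivial on the constants; the value -oo of \bar int
   is never taken, since v 1 = 0. *)
Record place (Fq : finFieldType) (F : functionField Fq) := Place {
  valuation :> F -> \bar int ;
  valuation_eqy : forall z, valuation z = +oo%E <-> z = 0 ;
  valuationM : forall y z,
    valuation (y * z) = (valuation y + valuation z)%E ;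
  valuationD : forall y z,
    (Order.min (valuation y) (valuation z) <= valuation (y + z)%R)%E ;
  valuation_const : forall c, c != 0 -> valuation (ff_const F c) = 0%E ;
  valuation_normalized : exists t, valuation t = 1%E
}.

HB.instance Definition _ (Fq : finFieldType) (F : functionField Fq) :=
  gen_eqMixin (place F).
HB.instance Definition _ (Fq : finFieldType) (F : functionField Fq) :=
  gen_choiceMixin (place F).

Section FunctionField.
Variables (Fq : finFieldType) (F : functionField Fq).
Implicit Types (P Q : place F) (D : place F -> int) (z : F).

(* For Fq-subspaces W \subset U of F: the quotient U / W has dimension n, i.e.
   some e_1, ..., e_n in U form a basis of U modulo W. *)
Definition has_dim_mod (U W : set F) (n : nat) : Prop :=
  exists e : 'I_n -> F, (forall i, U (e i)) /\
    forall u, U u -> exists! c : 'rV[Fq]_n,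
      W (u - \sum_i ff_const F (c 0 i) * e i).

(* The default 0 is a junk value for infinite-dimensional U / W; it does not
   affect residue fields and Riemann-Roch spaces, which are finite-dimensional. *)
Definition dim_mod (U W : set F) : nat := xget 0%N (has_dim_mod U W).

Definition valuation_ring P : set F := [set z | (0 <= P z)%E].
Definition maximal_ideal P : set F := [set z | (0 < P z)%E].

(* the dimension over Fq of the residue class field *)
Definition place_degree P : nat := dim_mod (valuation_ring P) (maximal_ideal P).

Definition is_divisor D : Prop := finite_set [set P | D P != 0].

(* The sum over an infinite support would be 0 by convention; pole divisors have
   finite support. *)
Definition divisor_degree D : int :=
  \sum_(P \in [set: place F]) D P * (place_degree P)%:Z.

Definition riemann_roch_space D : set F :=
  [set z | forall P, ((- D P)%:E <= P z)%E].

Definition rr_dim D : nat := dim_mod (riemann_roch_space D) [set 0].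

(* g is the maximum over all divisors D of deg D - l(D) + 1 *)
Definition is_genus (g : nat) : Prop :=
  (exists2 D, is_divisor D & divisor_degree D - (rr_dim D)%:Z + 1 = g%:Z) /\
  (forall D, is_divisor D -> divisor_degree D - (rr_dim D)%:Z + 1 <= g%:Z).

(* The maximum exists by Riemann's theorem, so the default 0 is harmless. *)
Definition genus : nat := xget 0%N is_genus.

(* [fine] sends the infinite value v_P(0) to 0, so that 0 has no poles. *)
Definition pole_divisor z : place F -> int :=
  fun P => Num.max 0 (- fine (P z)).

(* F is an m-friendly function field, as witnessed by the place Q and the
   function z1. *)
Record m_friendly (m : nat) Q (z1 : F) : Prop := MFriendly {
  friendly_genus : genus%:Z = m%:Z - 1 ;
  friendly_uniformizer : Q z1 = 1%E ;
  friendly_pole_degree : divisor_degree (pole_divisor z1) = 2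
}.

End FunctionField.

Lemma block_index_subproof (m s : nat) (i : 'I_m) (k : 'I_(s %/ m)) :
  (m %| s)%N -> (i * (s %/ m) + k < s)%N.
Proof.
move=> m_dvd_s; apply: (@leq_trans (i.+1 * (s %/ m))).
  by rewrite mulSn addnC ltn_add2r.
by rewrite -[leqRHS](divnK m_dvd_s) mulnC leq_mul2l ltn_ord orbT.
Qed.

Definition block_index (m s : nat) (m_dvd_s : (m %| s)%N) (i : 'I_m)
    (k : 'I_(s %/ m)) : 'I_s :=
  Ordinal (block_index_subproof i k m_dvd_s).

Definition col_block (K : Type) (m r s : nat) (m_dvd_s : (m %| s)%N)
    (A : 'M[K]_(r, s)) (i : 'I_m) : 'M[K]_(r, s %/ m) :=
  colsub (block_index m_dvd_s i) A.

Definition row_block (K : Type) (m s t : nat) (m_dvd_s : (m %| s)%N)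
    (B : 'M[K]_(s, t)) (j : 'I_m) : 'M[K]_(s %/ m, t) :=
  rowsub (block_index m_dvd_s j) B.

Lemma mulmx_blocks (K : pzRingType) (m r s t : nat) (m_dvd_s : (m %| s)%N)
    (A : 'M[K]_(r, s)) (B : 'M[K]_(s, t)) :
  A *m B = \sum_(i < m) col_block m_dvd_s A i *m row_block m_dvd_s B i.
Proof.
apply/matrixP => a b; rewrite summxE mxE.
under [RHS]eq_bigr => i _ do rewrite mxE.
rewrite pair_bigA /=.
have [d0|d_gt0] := posnP (s %/ m).
  rewrite !big1 // => [[i k]|x] _; first by have := ltn_ord k; rewrite [ltnRHS]d0.
  by have := ltn_ord x; rewrite -[ltnRHS](divnK m_dvd_s) d0.
rewrite (reindex (fun p : 'I_m * 'I_(s %/ m) => block_index m_dvd_s p.1 p.2)) /=.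
  by apply: eq_bigr => p _; rewrite !mxE.
have ltq (x : 'I_s) : (x %/ (s %/ m) < m)%N.
  by rewrite ltn_divLR // mulnC divnK.
have ltr (x : 'I_s) : (x %% (s %/ m) < s %/ m)%N by rewrite ltn_pmod.
exists (fun x => (Ordinal (ltq x), Ordinal (ltr x))) => [[i k] _|x _].
  by congr pair; apply: val_inj => /=;
    rewrite ?divnMDl // ?divn_small ?addn0 // modnMDl modn_small.
by apply: val_inj; rewrite /= -divn_eq.
Qed.

Section MatdotCode.
Variables (Fq : finFieldType) (F : functionField Fq) (m r s t : nat).
Variable m_dvd_s : (m %| s)%N.

Definition matdot_left (A : 'M[Fq]_(r, s)) (f_ : 'I_m -> F) :
    'M[F]_(r, s %/ m) :=
  \sum_i f_ i *: map_mx (ff_const F) (col_block m_dvd_s A i).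

Definition matdot_right (B : 'M[Fq]_(s, t)) (g_ : 'I_m -> F) :
    'M[F]_(s %/ m, t) :=
  \sum_j g_ j *: map_mx (ff_const F) (row_block m_dvd_s B j).

(* f and g are the encodings of A and B by the Matdot AG code with place Q and
   functions f_i, g_j. *)
Record matdot_AG_code (A : 'M[Fq]_(r, s)) (B : 'M[Fq]_(s, t)) (Q : place F)
    (f_ g_ : 'I_m -> F) (f : 'M[F]_(r, s %/ m)) (g : 'M[F]_(s %/ m, t)) :
    Prop := MatdotAGCode {
  matdot_left_neq0 : forall i, f_ i != 0 ;
  matdot_right_neq0 : forall j, g_ j != 0 ;
  matdot_valuation :
    exists d : int, forall i j, Q (f_ i * g_ j) = d%:E <-> i = j ;
  matdot_leftE : f = matdot_left A f_ ;
  matdot_rightE : g = matdot_right B g_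
}.

Lemma matdot_product (A : 'M[Fq]_(r, s)) (B : 'M[Fq]_(s, t))
    (f_ g_ : 'I_m -> F) :
  matdot_left A f_ *m matdot_right B g_ =
  \sum_i \sum_j (f_ i * g_ j) *: map_mx (ff_const F)
    (col_block m_dvd_s A i *m row_block m_dvd_s B j).
Proof.
rewrite /matdot_left mulmx_suml; apply: eq_bigr => i _.
rewrite mulmx_sumr; apply: eq_bigr => j _.
by rewrite -scalemxAl -scalemxAr scalerA map_mxM.
Qed.

End MatdotCode.

Section RecoveryThreshold.
Variables (Fq : finFieldType) (F : functionField Fq) (m : nat).

(* The pole divisor (h)_oo attached to the code, independently of A and B: the
   least common multiple, i.e. the place-wise maximum, of the pole divisors of
   the f_i g_j.  These being effective, 0 is a neutral start value. *)
Definition code_pole_divisor (f_ g_ : 'I_m -> F) : place F -> int :=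
  fun P => \big[Num.max/0]_i \big[Num.max/0]_j pole_divisor (f_ i * g_ j) P.

Definition recovery_threshold (f_ g_ : 'I_m -> F) : int :=
  divisor_degree (code_pole_divisor f_ g_) + 1.

End RecoveryThreshold.

(* Main.v *)
Require Import Defs.
From mathcomp Require Import all_boot all_order all_algebra.
From mathcomp Require Import constructive_ereal.
From mathcomp Require Import fsbigop.
From mathcomp Require Import zify.

Import Order.TTheory GRing.Theory Num.Theory.
Local Open Scope ring_scope.

(** Every product [f_ i * g_ j] is the power of [z1] with exponent m - 1 + i - j. As [z1] has
    valuation 1 at [Q], this exponent is the valuation at [Q], which settles the first claim. Pole
    divisors of powers scale with the exponent ([pole_divisorX]), so the largest exponent 2m - 2
    dominates at all places at once and the code has pole divisor 2(m - 1) times that of [z1]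
    ([code_pole_divisor_powers]). The degree of the latter is 2 and the genus is m - 1, which gives
    the threshold. *)

Section Valuations.
Set Implicit Arguments.
Unset Strict Implicit.
Variables (Fq : finFieldType) (F : functionField Fq).
Implicit Types (P : place F) (z : F) (D : place F -> int).

Lemma valuation1 P : P 1 = 0%E.
Proof. by rewrite -(rmorph1 (ff_const F)) valuation_const ?oner_neq0. Qed.

Lemma valuation_finite P z : z != 0 -> exists a : int, P z = a%:E.
Proof.
move=> z_neq0; case Pz: (P z) => [a||]; first by exists a.
  by move/valuation_eqy: Pz z_neq0 => ->; rewrite eqxx.
(* The value [-oo] absorbs every summand, so it would give 1 the valuation [-oo] instead of 0. *)
by have := valuationM P z z^-1; rewrite mulfV // valuation1 Pz addNye.
Qed.

Lemma valuationX P z (a : int) n : P z = a%:E -> P (z ^+ n) = (n%:Z * a)%:E.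
Proof.
move=> Pz; elim: n => [|n IHn]; first by rewrite expr0 valuation1 mul0r.
by rewrite exprS valuationM Pz IHn -EFinD; congr EFin; lia.
Qed.

(** Multiplication by the nonnegative integer n commutes with the maximum with 0. *)
Lemma pole_divisorX P z n :
  z != 0 -> pole_divisor (z ^+ n) P = n%:Z * pole_divisor z P.
Proof.
move=> /(@valuation_finite P)[a Pz].
by rewrite /pole_divisor (valuationX n Pz) Pz /= maxr_pMr // mulr0 mulrN.
Qed.

Lemma pole_divisor_ge0 z P : 0 <= pole_divisor z P.
Proof. by rewrite /pole_divisor le_max lexx. Qed.

Lemma divisor_degreeZ (n : int) D :
  divisor_degree (fun P => n * D P) = n * divisor_degree D.
Proof.
rewrite /divisor_degree mulr_fsumr.
by apply: eq_fsbigr => P _; rewrite mulrA.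
Qed.

(* The maximal exponent 2m - 2 is attained at i = m - 1, j = 0. *)
Lemma code_pole_divisor_powers m z P : (1 <= m)%N -> z != 0 ->
  code_pole_divisor (fun i : 'I_m => z ^+ i) (fun j => z ^+ (m - j.+1)) P =
  (2 * (m%:Z - 1)) * pole_divisor z P.
Proof.
case: m => // m _ z_neq0; have ge0 := pole_divisor_ge0 z P.
apply/le_anti/andP; split.
  (* Since the pole divisor is effective, bounding the exponents suffices; the first goal of each
     [bigmax_le] is the start value 0. *)
  apply: bigmax_le => [|i _]; first by rewrite mulr_ge0 //; lia.
  apply: bigmax_le => [|j _]; first by rewrite mulr_ge0 //; lia.
  rewrite -exprD pole_divisorX // ler_wpM2r //.
  by have := ltn_ord i; have := ltn_ord j; lia.
apply: (bigmax_sup ord_max) => //; apply: (bigmax_sup ord0) => //.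
by rewrite -exprD pole_divisorX // ler_wpM2r //=; lia.
Qed.

End Valuations.

Theorem theorem4p1 (Fq : finFieldType) (F : functionField Fq) (m : nat)
    (m_ge1 : (1 <= m)%N) (Q : place F) (z1 : F)
    (friendly : m_friendly m Q z1)
    (r s t : nat) (m_dvd_s : (m %| s)%N)
    (A : 'M[Fq]_(r, s)) (B : 'M[Fq]_(s, t)) :
  (* the indices i, j : 'I_m start at 0 *)
  let f_ := fun i : 'I_m => z1 ^+ i in
  let g_ := fun j : 'I_m => z1 ^+ (m - j.+1) in
  let f := \sum_(i < m) f_ i *: map_mx (ff_const F) (col_block m_dvd_s A i) in
  let g := \sum_(j < m) g_ j *: map_mx (ff_const F) (row_block m_dvd_s B j) in
  (forall i j : 'I_m, Q (f_ i * g_ j) = (m%:Z - 1)%:E <-> i = j) /\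
  matdot_AG_code m_dvd_s A B Q f_ g_ f g /\
  recovery_threshold f_ g_ = 2 * (genus F)%:Z + 2 * m%:Z - 1.
Proof.
move=> f_ g_ f g; case: friendly => genusE Qz1 deg_z1.
have z1_neq0 : z1 != 0 by apply/eqP => /(valuation_eqy Q); rewrite Qz1.
have Qfg (i j : 'I_m) : Q (f_ i * g_ j) = (m%:Z - 1)%:E <-> i = j.
  (* The truncated subtraction in the exponent i + (m - (j + 1)) is exact because j < m. *)
  rewrite -exprD (valuationX _ Qz1) mulr1.
  by have := ltn_ord i; have := ltn_ord j; split=> [[]|->];
    [move=> ?; apply: val_inj => /= | congr EFin]; lia.
split=> //; split.
  by split=> // [i|j|]; rewrite ?expf_neq0 //; exists (m%:Z - 1).
rewrite /recovery_threshold genusE.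
have -> : divisor_degree (code_pole_divisor f_ g_) =
          divisor_degree (fun P => (2 * (m%:Z - 1)) * pole_divisor z1 P).
  by apply: eq_fsbigr => P _; rewrite code_pole_divisor_powers.
(* Both sides equal 4m - 3. *)
by rewrite divisor_degreeZ deg_z1; lia.
Qed.
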